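(* There exists a sequence $(\varepsilon_k)_{k\ge 2}$ of nonnegative reals with $\varepsilon_k\to 0$ as $k\to\infty$ such that for all integers $k\geq 2$ and $n\geq 1$, $$f_2(n,k)\le \left\lfloor \frac{n}{k}\right\rfloor+(1+\varepsilon_k)\,k\binom{2k}{k}.$$ In other words, $c(k):=\sup_{n}\left\{f_2(n,k)-\lfloor n/k\rfloor\right\}\le (1+o(1))k\binom{2k}{k}$ as $k\to\infty$.
   Context: For a set $A$ and integer $k\ge1$, the Kneser graph $KG(A,k)$ has vertex set the family of all $k$-element subsets of $A$, two vertices $X,Y$ being adjacent iff $X\cap Y=\emptyset$; $KG(n,k)$ denotes a Kneser graph with an $n$-element base set. The xor-product $G\cdot H$ of graphs $G,H$ has vertex set $V(G)\times V(H)$, and $(g,h)$, $(g',h')$ are adjacent iff exactly one of the following holds: $gg'\in E(G)$, $hh'\in E(H)$. $f_\ell(n,k)$ denotes the clique number of the xor-product of $\ell$ copies of $KG(n,k)$. Equivalently, $f_2(n,k)$ is the maximum size of a family $\mathcal S$ of subsets of $A\cup B$, where $A,B$ are disjoint $n$-element sets, such that $|S\cap A|=|S\cap B|=k$ for all $S\in\mathcal S$, and any two distinct $S,T\in\mathcal S$ satisfy exactly one of $S\cap T\cap A=\emptyset$, $S\cap T\cap B=\emptyset$. *)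

(* Defs.v *)
From mathcomp Require Import all_boot.
From Stdlib Require Import Reals.
Set Implicit Arguments. Unset Strict Implicit. Unset Printing Implicit Defensive.

(* Vertices of KG(n,k) x KG(n,k): pairs (X,Y) of k-subsets of the base
   set 'I_n (two disjoint copies A, B of an n-element set). *)
Definition kvertex (n k : nat) (v : {set 'I_n} * {set 'I_n}) : bool :=
  (#|v.1| == k) && (#|v.2| == k).

Definition kneser_adj (n : nat) (X Y : {set 'I_n}) : bool := [disjoint X & Y].

Definition xor_adj (n : nat) (u v : {set 'I_n} * {set 'I_n}) : bool :=
  (kneser_adj u.1 v.1) (+) (kneser_adj u.2 v.2).

Definition xor_clique (n k : nat) (C : {set {set 'I_n} * {set 'I_n}}) : bool :=
  [forall u in C, kvertex k u] &&
  [forall u in C, forall v in C, (u != v) ==> xor_adj u v].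

Definition f2 (n k : nat) : nat :=
  \max_(C : {set {set 'I_n} * {set 'I_n}} | xor_clique k C) #|C|.

(* Main.v *)
Require Import Defs.
From mathcomp Require Import all_boot all_fingroup zify.
From Stdlib Require Import Reals Lra.
Set Implicit Arguments. Unset Strict Implicit. Unset Printing Implicit Defensive.

(** A family with pairwise disjoint A-parts and one with pairwise disjoint B-parts
    cannot both have more than 2k members, so by symmetry let every pairwise B-disjoint
    subfamily have at most 2k members; then each member meets at most 2k^2 others in A.
    Fix a maximal pairwise A-disjoint subfamily I; it has at most n/k members, and every
    v outside I is B-disjoint from some d in I.  As in Bollobas' set-pair theorem, take a
    random ordering of the base set and count the v outside I whose B-part precedes that
    of some d in I; each v is counted with probability at least 1/C(2k,k).  For a given
    ordering all counted v precede one common d, so they all meet d in A.  If there are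
    more than k of them, two of them meet in A, hence are B-disjoint, and their union
    precedes d: this has probability 1/C(3k,k) for each such triple, exponentially less
    than 1/C(2k,k), while the degree bounds leave only polynomially many triples per v. *)

(* Importing [Reals] rebinds [^] in [nat_scope]. *)
Local Notation "m ^ n" := (expn m n) : nat_scope.

(** * Orderings in which one set precedes another *)

(** Each pair is extended to a list of the whole type, and [t] sends every entry of the first list
    to the entry at the same position of the second. *)
Lemma perm_map_sets (T : finType) (X Y X' Y' : {set T}) :
  [disjoint X & Y] -> [disjoint X' & Y'] -> #|X| = #|X'| -> #|Y| = #|Y'| ->
  exists t : {perm T}, t @: X = X' /\ t @: Y = Y'.
Proof.
have enumU (U V : {set T}) : [disjoint U & V] ->
    let l := enum U ++ enum V ++ enum (~: (U :|: V)) in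
    [/\ uniq l, size l = #|T| & forall x, x \in l].
  move=> dUV l.
  have al x : x \in l by rewrite !mem_cat !mem_enum !inE; case: (x \in U) (x \in V) => [] [].
  have ul : uniq l.
    rewrite !cat_uniq !enum_uniq /= andbT; apply/andP; split; apply/hasPn=> x.
      rewrite mem_cat !mem_enum inE inE.
      by case: (boolP (x \in U)) => // xU; rewrite (disjointFr dUV xU).
    by rewrite !mem_enum !inE negb_or => /andP[].
  by split=> //; rewrite -(card_uniqP ul); apply: eq_card => x; exact: al.
move=> dXY dXY' cX cY.
set l := enum X ++ enum Y ++ enum (~: (X :|: Y)).
set l' := enum X' ++ enum Y' ++ enum (~: (X' :|: Y')).
have [ul sl al] : [/\ uniq l, size l = #|T| & forall x, x \in l] by apply: enumU.
have [ul' sl' al'] : [/\ uniq l', size l' = #|T| & forall x, x \in l'] by apply: enumU.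
have lt_index x : index x l < size l' by rewrite sl' -sl index_mem.
have finj : injective (fun x => nth x l' (index x l)).
  move=> x y /=; rewrite (set_nth_default y x) // => /eqP.
  by rewrite nth_uniq // => /eqP /index_inj-> //; apply: al.
exists (perm finj).
have sub (U U' : {set T}) : #|U| = #|U'| ->
    (forall x, x \in U -> nth x l' (index x l) \in U') -> perm finj @: U = U'.
  move=> cU sU; apply/eqP; rewrite eqEcard card_imset ?cU ?leqnn ?andbT; last exact: perm_inj.
  by apply/subsetP=> _ /imsetP[x xU ->]; rewrite permE sU.
split; apply: sub => // x xU.
  rewrite /l /l' index_cat mem_enum xU nth_cat -cardE -cX cardE index_mem mem_enum xU.
  by rewrite -mem_enum mem_nth // -cardE -cX cardE index_mem mem_enum.
rewrite /l /l' index_cat mem_enum (disjointFl dXY xU) nth_cat -!cardE -cX ltnNge leq_addr /=.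
rewrite addKn index_cat mem_enum xU nth_cat -cardE -cY cardE index_mem mem_enum xU.
by rewrite -mem_enum mem_nth // -cardE -cY cardE index_mem mem_enum.
Qed.

Definition before (n : nat) (s : {perm 'I_n}) (X Y : {set 'I_n}) : bool :=
  [forall x in X, forall y in Y, s x < s y].

Lemma beforeP (n : nat) (s : {perm 'I_n}) (X Y : {set 'I_n}) :
  reflect (forall x y, x \in X -> y \in Y -> s x < s y) (before s X Y).
Proof.
apply: (iffP forall_inP) => [h x y xX yY | h x xX].
  by move: (h x xX) => /forall_inP; apply.
by apply/forall_inP=> y yY; apply: h.
Qed.

Lemma before_disjoint (n : nat) (s : {perm 'I_n}) (X Y : {set 'I_n}) :
  before s X Y -> [disjoint X & Y].
Proof.
move=> /beforeP h; rewrite disjoint_subset; apply/subsetP=> x xX; rewrite inE.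
by apply/negP=> xY; have := h x x xX xY; rewrite ltnn.
Qed.

(** When [t] carries the first pair to the second, left multiplication by [t] is a bijection between
    the two sets of orderings. *)
Lemma card_before_eq (n : nat) (X Y X' Y' : {set 'I_n}) :
  [disjoint X & Y] -> [disjoint X' & Y'] -> #|X| = #|X'| -> #|Y| = #|Y'| ->
  #|[set s | before s X' Y']| = #|[set s | before s X Y]|.
Proof.
move=> dXY dXY' cX cY; have [t [<- <-]] := perm_map_sets dXY dXY' cX cY.
rewrite -(card_imset _ (@mulgI _ t)); apply: eq_card => s.
apply/imsetP/idP => [[r + ->]|].
  rewrite !inE => /beforeP h; apply/beforeP=> x y xX yY.
  by rewrite !permM; apply: h; apply: imset_f.
rewrite inE => /beforeP h; exists (t^-1 * s)%g; last by rewrite mulKVg.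
rewrite inE; apply/beforeP=> _ _ /imsetP[x xX ->] /imsetP[y yY ->].
by rewrite !permM !permK; apply: h.
Qed.

Lemma prefix_exists (n : nat) (s : {perm 'I_n}) (U : {set 'I_n}) (a : nat) :
  a <= #|U| -> exists X : {set 'I_n}, [/\ X \subset U, #|X| = a & before s X (U :\: X)].
Proof.
elim: a => [_|a IH lt_a].
  exists set0; rewrite sub0set cards0; split=> //.
  by apply/beforeP=> x y; rewrite inE.
have [X [sXU cX /beforeP bX]] := IH (ltnW lt_a).
have /card_gt0P[z0 z0U] : 0 < #|U :\: X| by rewrite cardsDS // cX subn_gt0.
(* The initial segment grows by the [s]-earliest remaining element of [U]. *)
have [z zU zmin] := @arg_minnP _ z0 [in U :\: X] (fun x => s x : nat) z0U.
move: (zU); rewrite inE => /andP[zX zUU].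
exists (z |: X); split.
- by rewrite subUset sub1set zUU.
- by rewrite cardsU1 zX cX.
apply/beforeP=> x y; rewrite !inE negb_or => /orP[/eqP->|xX] /andP[/andP[yz yX] yU].
  rewrite ltn_neqAle zmin ?andbT ?inE ?yX //.
  by apply: contraNneq yz => /val_inj/perm_inj->.
by apply: bX; rewrite ?inE ?yX.
Qed.

Lemma prefix_unique (n : nat) (s : {perm 'I_n}) (U X X' : {set 'I_n}) :
  X \subset U -> X' \subset U -> #|X| = #|X'| ->
  before s X (U :\: X) -> before s X' (U :\: X') -> X = X'.
Proof.
move=> sX sX' cX /beforeP b /beforeP b'; apply/eqP; rewrite eqEcard cX leqnn andbT.
apply/negPn/negP=> /subsetPn[x xX xX'].
have /subsetPn[y yX' yX] : ~~ (X' \subset X).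
  apply: contra xX' => sXX'; suff -> : X' = X by [].
  by apply/eqP; rewrite eqEcard sXX' cX leqnn.
have := b x y xX; rewrite inE yX (subsetP sX') // => /(_ isT) lt1.
have := b' y x yX'; rewrite inE xX' (subsetP sX) // => /(_ isT).
by rewrite ltnNge ltnW.
Qed.

(** Each ordering makes exactly one [#|X|]-subset of the union its initial segment, and by symmetry
    all such subsets occur equally often. *)
Lemma card_before (n : nat) (X Y : {set 'I_n}) :
  [disjoint X & Y] ->
  #|[set s : {perm 'I_n} | before s X Y]| * 'C(#|X| + #|Y|, #|X|) = n`!.
Proof.
move=> dXY; set U := X :|: Y.
have cU : #|U| = #|X| + #|Y| by rewrite cardsU disjoint_setI0 // cards0 subn0.
pose P := [set X' : {set 'I_n} | X' \subset U & #|X'| == #|X|].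
rewrite -cU -cards_draws -/P mulnC -sum_nat_const.
transitivity (\sum_(X' in P) #|[set s : {perm 'I_n} | before s X' (U :\: X')]|).
  apply: eq_bigr => X'; rewrite inE => /andP[sX'U /eqP cX'].
  apply/esym/card_before_eq; rewrite ?cX' //.
    by rewrite disjoint_sym disjoints_subset setDE subsetIr.
  by rewrite cardsDS // cU cX' addKn.
under eq_bigr => X' _ do rewrite -sum1_card big_mkcond /=.
rewrite exchange_big /= -(card_Sn n) -sum1_card; apply: eq_big => // s _.
have [X0 [sX0 cX0 bX0]] := prefix_exists s (leq_trans (leq_addr #|Y| #|X|) (eq_leq (esym cU))).
rewrite (bigD1 X0) /=; last by rewrite inE sX0 cX0 /=.
rewrite inE bX0 big1 // => X'; rewrite inE => /andP[/andP[sX' /eqP cX'] /negP neq].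
rewrite inE; case: ifP => // bX'; case: neq; apply/eqP.
by apply: (prefix_unique sX' sX0) bX' bX0; rewrite cX0.
Qed.

(** * Pairwise disjoint families and the clique condition *)

Definition pairwise_disjoint (T G : finType) (F : T -> {set G}) (J : {set T}) : Prop :=
  {in J &, forall u v, u != v -> [disjoint F u & F v]}.

Lemma card_setId_sum (T : finType) (J : {set T}) (p : pred T) :
  #|[set j in J | p j]| = \sum_(j in J) p j.
Proof. by rewrite -sum1dep_card big_mkcondr. Qed.

Lemma card_setI_sum (T : finType) (J K : {set T}) : #|J :&: K| = \sum_(j in J) (j \in K).
Proof. by rewrite -card_setId_sum; apply: eq_card => j; rewrite !inE. Qed.

Lemma sum_card_setI_swap (T G : finType) (F : T -> {set G}) (J : {set T}) (X : {set G}) :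
  \sum_(j in J) #|X :&: F j| = \sum_(x in X) #|[set j in J | x \in F j]|.
Proof.
under eq_bigr => j _ do rewrite card_setI_sum.
by rewrite exchange_big; apply: eq_bigr => x _; rewrite card_setId_sum.
Qed.

Lemma sum_card_pairwise_disjoint (T G : finType) (F : T -> {set G}) (J : {set T}) (X : {set G}) :
  pairwise_disjoint F J -> \sum_(j in J) #|X :&: F j| <= #|X|.
Proof.
move=> dJ; rewrite sum_card_setI_swap -sum1_card; apply: leq_sum => x _.
apply/card_le1_eqP => u v; rewrite !inE => /andP[uJ xu] /andP[vJ xv].
apply/eqP; apply: contraLR xv => vu.
by rewrite eq_sym in vu; rewrite (disjointFr (dJ u v uJ vJ vu) xu).
Qed.

Lemma card_hit_pairwise_disjoint (T G : finType) (F : T -> {set G}) (J : {set T}) (X : {set G}) :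
  pairwise_disjoint F J -> #|[set j in J | ~~ [disjoint X & F j]]| <= #|X|.
Proof.
move=> dJ; apply: leq_trans (sum_card_pairwise_disjoint X dJ).
rewrite card_setId_sum; apply: leq_sum => j _.
by rewrite -setI_eq0 -card_gt0; case: #|_|.
Qed.

(** Indexing the clique by a type, with its two parts as functions, lets the roles of [A] and [B] be
    exchanged. *)
Definition set_pair_clique (T : finType) (n k : nat) (A B : T -> {set 'I_n}) : Prop :=
  [/\ forall u, #|A u| = k, forall u, #|B u| = k
    & forall u v, u != v -> [disjoint A u & A v] (+) [disjoint B u & B v]].

(** Any [u] in [K] and [j] in [J] meet in [A] or in [B], yet each [u] meets at most [k] of the [A j]
    and each [j] at most [k] of the [B u]. Hence |J||K| <= k(|J| + |K|), which fails once both
    exceed 2k. *)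
Lemma disjoint_families_small (T : finType) (n k : nat) (A B : T -> {set 'I_n})
    (J K : {set T}) :
  0 < k -> set_pair_clique k A B -> pairwise_disjoint A J -> pairwise_disjoint B K ->
  (#|J| <= 2 * k) || (#|K| <= 2 * k).
Proof.
move=> k0 [cA cB xAB] dJ dK.
have hJ u : #|[set j in J | ~~ [disjoint A u & A j]]| <= k.
  by rewrite -[leqRHS](cA u); apply: card_hit_pairwise_disjoint.
have hK j : #|[set u in K | ~~ [disjoint B j & B u]]| <= k.
  by rewrite -[leqRHS](cB j); apply: card_hit_pairwise_disjoint.
have sJK : \sum_(u in K) #|[set j in J | ~~ [disjoint A u & A j]]| <= #|K| * k.
  by rewrite -sum_nat_const; apply: leq_sum.
have sKJ : \sum_(j in J) #|[set u in K | ~~ [disjoint B j & B u]]| <= #|J| * k.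
  by rewrite -sum_nat_const; apply: leq_sum.
suff : #|K| * #|J| <= #|K| * k + #|J| * k by nia.
apply: leq_trans (leq_add sJK sKJ).
under eq_bigr => u _ do rewrite card_setId_sum.
under [X in _ + X]eq_bigr => j _ do rewrite card_setId_sum.
rewrite [X in _ + X]exchange_big /= -big_split /= -sum_nat_const.
apply: leq_sum => u uK; rewrite -big_split /= -sum1_card; apply: leq_sum => j jJ.
have [<-|uj] := eqVneq u j.
  by rewrite -setI_eq0 setIid -cards_eq0 cA -lt0n k0.
by have := xAB _ _ uj; rewrite (disjoint_sym (B j)); do 2 case: [disjoint _ & _].
Qed.

(** * Degree bounds and the random-ordering count *)

Section Counting.
Variables (T : finType) (n k : nat) (A B : T -> {set 'I_n}).
Hypotheses (k_gt0 : 0 < k) (AB : set_pair_clique k A B).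
Hypothesis smallK : forall K : {set T}, pairwise_disjoint B K -> #|K| <= 2 * k.

Let cA u : #|A u| = k. Proof. by case: AB. Qed.
Let cB u : #|B u| = k. Proof. by case: AB. Qed.

Lemma meet_self (F : T -> {set 'I_n}) u : #|F u| = k -> ~~ [disjoint F u & F u].
Proof. by move=> c; rewrite -setI_eq0 setIid -cards_eq0 c -lt0n. Qed.

Lemma meetA_disjB u v : u != v -> [disjoint B u & B v] = ~~ [disjoint A u & A v].
Proof. by case: AB => _ _ h /h; do 2 case: [disjoint _ & _]. Qed.

(** Members sharing a point of [A d] pairwise meet in [A], so they are pairwise [B]-disjoint: at
    most 2k for each of the k points. *)
Lemma degree_bound d : #|[set v | ~~ [disjoint A d & A v]]| <= 2 * k ^ 2.
Proof.
apply: (@leq_trans (\sum_(v in [set: T]) #|A d :&: A v|)).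
  rewrite -sum1dep_card big_mkcond [leqRHS]big_mkcond /=; apply: leq_sum => v _.
  by rewrite inE -setI_eq0 -card_gt0; case: #|_|.
have -> : 2 * k ^ 2 = #|A d| * (2 * k) by rewrite cA; lia.
rewrite sum_card_setI_swap -sum_nat_const.
apply: leq_sum => x _; apply: smallK => u v; rewrite !inE /= => xu xv uv.
rewrite meetA_disjB // -setI_eq0; apply/set0Pn; exists x.
by rewrite inE xu.
Qed.

Lemma meetB_disj_degree u : #|[set v | [disjoint B u & B v]]| <= 2 * k ^ 2.
Proof.
apply: leq_trans (degree_bound u); apply: subset_leq_card; apply/subsetP=> v.
rewrite !inE => d; rewrite -meetA_disjB //.
by apply: contraTneq d => ->; apply: meet_self.
Qed.

Variable I : {set T}.
Hypothesis maxI : forall v, v \notin I -> exists2 d, d \in I & ~~ [disjoint A v & A d].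

Definition precede (s : {perm 'I_n}) (d : T) : {set T} :=
  [set v in ~: I | before s (B v) (B d)].

Definition preceding (s : {perm 'I_n}) : {set T} := \bigcup_(d in I) precede s d.

(** An entry [(v, (w, d))] is a candidate for [v] and [w] both preceding [d]; the list does not
    depend on the ordering, so a union bound applies. *)
Definition triples : {set T * (T * T)} :=
  [set t | [&& t.1 \notin I, [disjoint B t.1 & B t.2.1], [disjoint B t.1 & B t.2.2]
             & [disjoint B t.2.1 & B t.2.2]]].

(* The sets [precede s d] form a chain, so the largest one contains all the others. *)
Lemma preceding_eq (s : {perm 'I_n}) :
  preceding s != set0 -> exists d, preceding s = precede s d.
Proof.
case/set0Pn=> v0 /bigcupP[d0 d0I _].
have [d dI dmax] := @arg_maxnP _ d0 [in I] (fun d => #|precede s d|) d0I.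
exists d; apply/eqP; rewrite eqEsubset bigcup_sup // andbT.
apply/bigcupsP=> d' d'I; apply/subsetP=> v vd'.
apply/negPn/negP=> vd; have := dmax d' d'I; apply/negP; rewrite -ltnNge.
apply: proper_card; apply/properP; split; last by exists v.
move: vd' vd; rewrite !inE => /andP[-> /beforeP bv] /=.
(* Some [y] in [B d] comes no later than an [x] in [B v], and [x] precedes all of [B d']; so
   whatever precedes [d] also precedes [d']. *)
case/forall_inPn=> x xBv /forall_inPn[y yBd]; rewrite -leqNgt => yx.
apply/subsetP=> w; rewrite !inE => /andP[-> /beforeP bw] /=.
apply/beforeP=> z y' zw y'd'.
exact: ltn_trans (leq_trans (bw z y zw yBd) yx) (bv x y' xBv y'd').
Qed.

Lemma precede_meet (s : {perm 'I_n}) (d v : T) :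
  v \in precede s d -> ~~ [disjoint A d & A v].
Proof.
rewrite inE => /andP[_ /before_disjoint dB].
rewrite -meetA_disjB; first by rewrite disjoint_sym.
by apply: contraTneq dB => ->; apply: meet_self.
Qed.

Lemma card_precede_le (s : {perm 'I_n}) (d : T) : #|precede s d| <= 2 * k ^ 2.
Proof.
apply: leq_trans (degree_bound d); apply: subset_leq_card; apply/subsetP=> v vd.
by rewrite inE (precede_meet vd).
Qed.

Lemma card_preceding_le (s : {perm 'I_n}) : #|preceding s| <= 2 * k ^ 2.
Proof.
have [->|/preceding_eq[d ->]] := eqVneq (preceding s) set0; first by rewrite cards0.
exact: card_precede_le.
Qed.

(** All counted members meet the k-set [A d] of one common [d]. If there are more than k, two of
    them meet in [A], hence are [B]-disjoint and form a triple with [d]; then the second summand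
    alone exceeds the degree bound or equals it. *)
Lemma card_preceding_le_triples (s : {perm 'I_n}) :
  #|preceding s| <= k + 2 * k ^ 2 *
    #|[set t in triples | before s (B t.1 :|: B t.2.1) (B t.2.2)]|.
Proof.
have [->|/preceding_eq[d ->]] := eqVneq (preceding s) set0; first by rewrite cards0.
case: (leqP #|precede s d| k) => [/leq_trans->//|k_lt]; first exact: leq_addr.
apply: leq_trans (card_precede_le s d) _; apply: leq_trans (leq_addl k _).
rewrite leq_pmulr // card_gt0; apply/set0Pn.
have /exists_inP[v vd /exists_inP[w wd vw]] : [exists v in precede s d,
    [exists w in precede s d, [disjoint B v & B w]]].
  apply: contraLR k_lt => /exists_inPn h; rewrite -leqNgt.
  rewrite -(cA d); apply: leq_trans (card_hit_pairwise_disjoint (A d) (_ : pairwise_disjoint A (precede s d))).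
    apply: subset_leq_card; apply/subsetP=> v vd.
    by rewrite inE vd (precede_meet vd).
  move=> v w vd wd vw; have /exists_inPn/(_ w wd) := h v vd.
  by rewrite meetA_disjB // negbK.
exists (v, (w, d)); move: vd wd; rewrite !inE /= vw => /andP[-> bv] /andP[_ bw] /=.
rewrite !(before_disjoint bv, before_disjoint bw) /=; apply/beforeP=> x y.
by rewrite inE => /orP[]; [move/beforeP: bv => h | move/beforeP: bw => h]; apply: h.
Qed.

(** Given [v], both [w] and [d] are among the at most 2k^2 members [B]-disjoint from [v]. *)
Lemma card_triples : #|triples| <= #|~: I| * (2 * k ^ 2) ^ 2.
Proof.
pose N u := [set v | [disjoint B u & B v]].
rewrite -sum1_card.
apply: (@leq_trans (\sum_(u in ~: I) \sum_(p in setX (N u) (N u)) 1)).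
  rewrite pair_big_dep /= [leqLHS]big_mkcond [leqRHS]big_mkcond /=.
  apply: leq_sum => -[u [v w]] _; rewrite !inE /=.
  by case: (u \in I); do 3 case: [disjoint _ & _].
rewrite -sum_nat_const; apply: leq_sum => u _.
by rewrite sum1_card cardsX expnS expn1 leq_mul // meetB_disj_degree.
Qed.

Let C2 := 'C(2 * k, k).
Let C3 := 'C(3 * k, k).

(** Each [v] outside [I] meets some [d] in [I] in [A], so [B v] and [B d] are disjoint and [v]
    precedes [d] with probability 1/C(2k,k). *)
Lemma sum_preceding_ge : #|~: I| * n`! <= C2 * \sum_s #|preceding s|.
Proof.
have -> : \sum_(s : {perm 'I_n}) #|preceding s| =
    \sum_(v in ~: I) #|[set s | v \in preceding s]|.
  transitivity (\sum_(s : {perm 'I_n}) \sum_(v in ~: I) (v \in preceding s : nat)).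
    apply: eq_bigr => s _; rewrite -sum1_card big_mkcond [RHS]big_mkcond /=.
    apply: eq_bigr => v _; case: ifP => [/bigcupP[d _]|]; last by case: ifP.
    by rewrite inE => /andP[->].
  by rewrite exchange_big; apply: eq_bigr => v _; rewrite -sum1dep_card [RHS]big_mkcond.
rewrite big_distrr -sum_nat_const /=; apply: leq_sum => v; rewrite inE => vI.
have [d dI vd] := maxI vI.
have dB : [disjoint B v & B d].
  by rewrite meetA_disjB //; apply: contraNneq vI => ->.
rewrite -(card_before dB) !cB addnn -mul2n mulnC leq_mul2l subset_leq_card ?orbT //.
apply/subsetP=> s; rewrite !inE => b; apply/bigcupP; exists d => //.
by rewrite !inE vI.
Qed.

Lemma sum_preceding_le : \sum_s #|preceding s| <= 2 * k ^ 2 * n`!.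
Proof.
rewrite -(card_Sn n) mulnC -sum_nat_const.
by rewrite [leqRHS](eq_bigl xpredT) //; apply: leq_sum => s _; apply: card_preceding_le.
Qed.

Lemma sum_preceding_le_triples :
  C3 * \sum_s #|preceding s| <= (C3 * k + 2 * k ^ 2 * #|triples|) * n`!.
Proof.
apply: (@leq_trans (C3 * \sum_(s : {perm 'I_n}) (k + 2 * k ^ 2 *
    #|[set t in triples | before s (B t.1 :|: B t.2.1) (B t.2.2)]|))).
  by rewrite leq_mul2l; apply/orP; right; apply: leq_sum => s _; apply: card_preceding_le_triples.
rewrite big_split /= -big_distrr /= mulnDr mulnDl; apply: leq_add.
  by rewrite sum_nat_const card_Sn mulnC -!mulnA (mulnC k) mulnC -mulnA (mulnC k).
rewrite mulnCA -[leqRHS]mulnA leq_mul2l; apply/orP; right.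
have -> : \sum_(s : {perm 'I_n})
      #|[set t in triples | before s (B t.1 :|: B t.2.1) (B t.2.2)]| =
    \sum_(t in triples) #|[set s : {perm 'I_n} | before s (B t.1 :|: B t.2.1) (B t.2.2)]|.
  transitivity (\sum_(s : {perm 'I_n}) \sum_(t in triples)
      (before s (B t.1 :|: B t.2.1) (B t.2.2) : nat)).
    by apply: eq_bigr => s _; rewrite card_setId_sum.
  by rewrite exchange_big; apply: eq_bigr => t _; rewrite -sum1dep_card [RHS]big_mkcond.
rewrite big_distrr -sum_nat_const /=; apply: leq_sum => -[v [w d]]; rewrite inE /=.
case/and4P=> _ vw vd wd.
have dU : [disjoint B v :|: B w & B d].
  by rewrite -setI_eq0 setIUl setU_eq0 !setI_eq0 vd.
rewrite -(card_before dU) cardsU disjoint_setI0 // cards0 subn0 !cB mulnC.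
have -> : k + k = 2 * k by lia.
have -> : 2 * k + k = 3 * k by lia.
(* The union has 2k points, so the count gives C(3k,2k) = C(3k,k). *)
by rewrite -(@bin_sub (3 * k) (2 * k)) ?leq_mul // -mulnBl mul1n.
Qed.

(** A bootstrap: the crude bound [R1] limits the triples to 8 k^6 C(2k,k), and the refined estimate
    multiplies this by 2k^2, whence 16 k^8. *)
Lemma card_complement_bound : C3 * #|~: I| <= C2 * (C3 * k + 16 * k ^ 8 * C2).
Proof.
have R1 : #|~: I| <= C2 * (2 * k ^ 2).
  rewrite -(leq_pmul2r (fact_gt0 n)) -mulnA; apply: leq_trans sum_preceding_ge _.
  by rewrite leq_mul2l sum_preceding_le orbT.
rewrite -(leq_pmul2r (fact_gt0 n)) -!mulnA.
apply: leq_trans (leq_mul (leqnn C3) sum_preceding_ge) _.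
rewrite mulnCA leq_mul2l; apply/orP; right.
apply: leq_trans sum_preceding_le_triples _.
rewrite leq_mul2r leq_add2l; apply/orP; right.
apply: leq_trans (leq_mul (leqnn _) card_triples) _.
apply: leq_trans (leq_mul (leqnn _) (leq_mul R1 (leqnn _))) _.
by move: C2 => a; apply: eq_leq; rewrite !expnS !expn0; lia.
Qed.
End Counting.

(** * From set-pair families to [f2] *)

Lemma maximal_pairwise_disjoint (T G : finType) (F : T -> {set G}) :
  exists I : {set T}, pairwise_disjoint F I /\
    forall v, v \notin I -> exists2 d, d \in I & ~~ [disjoint F v & F d].
Proof.
pose P (J : {set T}) := [forall u in J, forall v in J, (u != v) ==> [disjoint F u & F v]].
have PP J : reflect (pairwise_disjoint F J) (P J).
  apply: (iffP forall_inP) => [h u v uJ vJ uv | h u uJ].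
    by have /forall_inP/(_ v vJ)/implyP := h u uJ; apply.
  by apply/forall_inP=> v vJ; apply/implyP; apply: h.
have P0 : P set0 by apply/PP=> u v; rewrite inE.
have [I /PP dI maxI] := @arg_maxnP _ set0 P (fun J : {set T} => #|J|) P0.
exists I; split=> // v vI; apply/exists_inP; apply: contraNT vI => /exists_inPn dv.
have /maxI : P (v |: I).
  have dvI u : u \in I -> [disjoint F v & F u] by move=> /dv; rewrite negbK.
  apply/PP=> u w; rewrite !inE => /orP[/eqP->|uI] /orP[/eqP->|wI]; rewrite ?eqxx // => uw.
  - exact: dvI.
  - by rewrite disjoint_sym dvI.
  - exact: dI.
by rewrite cardsU1; case: (v \in I) => //=; rewrite add1n ltnn.
Qed.

Lemma card_pairwise_disjoint_le (T : finType) (n k : nat) (F : T -> {set 'I_n}) (J : {set T}) :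
  0 < k -> (forall u, #|F u| = k) -> pairwise_disjoint F J -> #|J| <= n %/ k.
Proof.
move=> k0 cF dJ; rewrite leq_divRL // -sum_nat_const -[leqRHS]card_ord -cardsT.
apply: leq_trans (sum_card_pairwise_disjoint [set: 'I_n] dJ).
by apply: leq_sum => u _; rewrite setTI cF.
Qed.

(** Here [r] counts the members outside a maximal [A]-disjoint subfamily; its bound stays multiplied
    by C(3k,k) to avoid division. *)
Lemma set_pair_clique_bound_small (T : finType) (n k : nat) (A B : T -> {set 'I_n}) :
  0 < k -> set_pair_clique k A B ->
  (forall K : {set T}, pairwise_disjoint B K -> #|K| <= 2 * k) ->
  exists2 r, #|T| <= n %/ k + r &
    'C(3 * k, k) * r <= 'C(2 * k, k) * ('C(3 * k, k) * k + 16 * k ^ 8 * 'C(2 * k, k)).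
Proof.
move=> k0 AB smallK; have [I [dI maxI]] := maximal_pairwise_disjoint A.
exists #|~: I|; last exact: (card_complement_bound k0 AB smallK maxI).
rewrite -(cardsC I) leq_add2r; apply: card_pairwise_disjoint_le k0 _ dI.
by case: AB.
Qed.

Lemma set_pair_clique_bound (T : finType) (n k : nat) (A B : T -> {set 'I_n}) :
  0 < k -> set_pair_clique k A B ->
  exists2 r, #|T| <= n %/ k + r &
    'C(3 * k, k) * r <= 'C(2 * k, k) * ('C(3 * k, k) * k + 16 * k ^ 8 * 'C(2 * k, k)).
Proof.
move=> k0 AB.
have BA : set_pair_clique k B A.
  by case: AB => cA cB h; split=> // u v /h; rewrite addbC.
have [I [dI _]] := maximal_pairwise_disjoint A.
have [/existsP[K /andP[/forall_inP dK ltK]]|/existsPn small] := boolP [exists K : {set T},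
    [forall u in K, forall v in K, (u != v) ==> [disjoint B u & B v]] && (2 * k < #|K|)].
  (* A [B]-disjoint [K] with more than 2k members forces all [A]-disjoint subfamilies to be small,
     so the roles are swapped. *)
  apply: (set_pair_clique_bound_small k0 BA) => J dJ.
  have dK' : pairwise_disjoint B K.
    by move=> u v uK vK; have /forall_inP/(_ v vK)/implyP := dK u uK.
  by case/orP: (disjoint_families_small k0 AB dJ dK') => //; rewrite leqNgt ltK.
apply: (set_pair_clique_bound_small k0 AB) => K dK.
have := small K; rewrite negb_and -leqNgt => /orP[/negP[]|//].
by apply/forall_inP=> u uK; apply/forall_inP=> v vK; apply/implyP; apply: dK.
Qed.

Lemma f2_bound (n k : nat) : 0 < k ->
  exists2 r, f2 n k <= n %/ k + r &
    'C(3 * k, k) * r <= 'C(2 * k, k) * ('C(3 * k, k) * k + 16 * k ^ 8 * 'C(2 * k, k)).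
Proof.
move=> k0; rewrite /f2.
have [|C /andP[/forall_inP vC /forall_inP aC] ->] :=
    @eq_bigmax_cond _ (@xor_clique n k) (fun C => #|C|).
  (* The empty clique ensures that the maximum is attained. *)
  apply/card_gt0P; exists set0.
  by apply/andP; split; apply/forall_inP=> u; rewrite inE.
pose T := {u | u \in C}.
rewrite -(card_sig (mem C)).
apply: (@set_pair_clique_bound T n k (fun u => (val u).1) (fun u => (val u).2)) => //.
split=> [[u uC]|[u uC]|[u uC] [v vC'] uv] /=.
- by have /andP[/eqP] := vC u uC.
- by have /andP[_ /eqP] := vC u uC.
by have /forall_inP/(_ v vC')/implyP := aC u uC; apply.
Qed.

(** * Numerical estimates and the limit *)

(** After multiplication by k! both binomials are falling factorials, compared factor by factor:
    3(2k - i) <= 2(3k - i). *)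
Lemma bin_ratio_bound (k : nat) : 3 ^ k * 'C(2 * k, k) <= 2 ^ k * 'C(3 * k, k).
Proof.
rewrite -(leq_pmul2r (fact_gt0 k)) -!mulnA !bin_ffact !ffact_prod.
have pow a : a ^ k = \prod_(i < k) a by rewrite prod_nat_const card_ord.
rewrite !pow -!big_split /=; apply: leq_prod => i _.
by move: (ltn_ord i); lia.
Qed.

(* Bernoulli for 21/20, whose eighth power is below 3/2. *)
Lemma poly8_geometric_bound (k : nat) :
  (INR k ^ 8 * 2 ^ k <= 20 ^ 8 * 3 ^ k)%R.
Proof.
have bern : (INR k <= 20 * (21 / 20) ^ k)%R.
  have := poly k (1 / 20) ltac:(lra).
  by replace (1 + 1 / 20)%R with (21 / 20)%R by lra; lra.
have pow8 : (INR k ^ 8 <= 20 ^ 8 * ((21 / 20) ^ 8) ^ k)%R.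
  rewrite -pow_mult Nat.mul_comm pow_mult -Rpow_mult_distr.
  by apply: pow_incr; split=> //; apply: pos_INR.
have le32 : (((21 / 20) ^ 8) ^ k <= (3 / 2) ^ k)%R by apply: pow_incr; lra.
have -> : (3 ^ k = (3 / 2) ^ k * 2 ^ k)%R.
  by rewrite -Rpow_mult_distr; congr (_ ^ _)%R; lra.
rewrite -Rmult_assoc; apply: Rmult_le_compat_r; first by apply: pow_le; lra.
apply: Rle_trans pow8 _; apply: Rmult_le_compat_l => //; apply: pow_le; lra.
Qed.

Lemma INR_expn (m e : nat) : INR (m ^ e) = (INR m ^ e)%R.
Proof. by elim: e => [|e IH] //; rewrite expnS mult_INR IH. Qed.

(** Division by C(3k,k) leaves the error 16 k^8 C(2k,k)^2 / C(3k,k), where k^8 C(2k,k) / C(3k,k) <=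
    k^8 (2/3)^k <= 20^8. *)
Lemma f2_le (n k : nat) : 0 < k ->
  (INR (f2 n k) <= INR (n %/ k) + (INR k + 16 * 20 ^ 8) * INR 'C(2 * k, k))%R.
Proof.
move=> k0; have [r /leP/le_INR f2r /leP/le_INR] := f2_bound n k0.
move: (bin_ratio_bound k) => /leP/le_INR.
rewrite plus_INR in f2r.
rewrite !(INR_expn, mult_INR) plus_INR !(INR_expn, mult_INR).
have -> : INR 3 = 3%R by simpl; lra.
have -> : INR 2 = 2%R by simpl; lra.
have -> : INR 16 = 16%R by simpl; lra.
have c3 : (0 < INR 'C(3 * k, k))%R by apply/lt_0_INR/ltP; rewrite bin_gt0; lia.
have c2 : (0 < INR 'C(2 * k, k))%R by apply/lt_0_INR/ltP; rewrite bin_gt0; lia.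
move: c3 c2 (poly8_geometric_bound k).
have p2 : (0 < 2 ^ k)%R by apply: pow_lt; lra.
have p3 : (0 < 3 ^ k)%R by apply: pow_lt; lra.
have := pow_le _ 8 (pos_INR k).
move: (INR 'C(2 * k, k)) (INR 'C(3 * k, k)) f2r p2 p3 => c2 c3.
move: (INR k) (INR k ^ 8)%R (2 ^ k)%R (3 ^ k)%R (20 ^ 8)%R => x x8 a b K f2r a0 b0 x80 c30 c20 hx hb hr.
have h8 : (x8 * c2 <= K * c3)%R.
  apply: (Rmult_le_reg_l (a * b)); first exact: Rmult_lt_0_compat.
  have h1 : ((x8 * a) * (b * c2) <= (K * b) * (a * c3))%R.
    apply: Rmult_le_compat => //; apply: Rmult_le_pos; lra.
  lra.
have : (INR r <= (x + 16 * K) * c2)%R.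
  apply: (Rmult_le_reg_l c3) => //; apply: Rle_trans hr _.
  have : (c2 * (x8 * c2) <= c2 * (K * c3))%R by apply: Rmult_le_compat_l => //; lra.
  lra.
lra.
Qed.

Theorem theorem1p1 :
  exists eps : nat -> R,
    (forall k : nat, (2 <= k)%N -> (0 <= eps k)%R) /\
    Un_cv eps 0%R /\
    (forall k n : nat, (2 <= k)%N -> (1 <= n)%N ->
       (INR (f2 n k) <=
          INR (n %/ k) + (1 + eps k) * INR k * INR 'C(2 * k, k))%R).
Proof.
have K0 : (0 < 16 * 20 ^ 8)%R by lra.
(* With this choice k times [eps k] is exactly the additive constant of [f2_le]. *)
exists (fun k => 16 * 20 ^ 8 * / INR k)%R.
have pos k : 1 < k -> (0 < INR k)%R by move=> k2; apply/lt_0_INR/ltP; lia.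
split=> [k /pos k0|].
  by apply: Rmult_le_pos; [lra | apply/Rlt_le/Rinv_0_lt_compat].
split=> [|k n k2 _].
  rewrite -(Rmult_0_r (16 * 20 ^ 8)); apply: (CV_mult (fun=> 16 * 20 ^ 8)%R).
    by move=> e e0; exists 0 => m _; rewrite Rdist_eq.
  apply: cv_infty_cv_0 => M; have [N hN] := INR_unbounded M.
  by exists N => m /le_INR; lra.
apply: Rle_trans (f2_le n (ltnW k2)) _; apply/Req_le; field.
by have := pos k k2; lra.
Qed.
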